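(* There exists an affine isometric action of $\mathbf{Z}$ on a complex Hilbert space, that is neither proper nor bounded, and whose linear part has no nonzero finite-dimensional subrepresentation.
   Context: An affine isometric action of $\mathbf{Z}$ on a complex Hilbert space $\mathcal{H}$ is an action $\alpha(n)v=\pi(n)v+b(n)$ whose linear part $\pi$ is a unitary representation. It is bounded if its orbits are bounded, and proper if $\|\alpha(n)v\|\to\infty$ as $|n|\to\infty$ for some (equivalently every) $v\in\mathcal{H}$. *)

(* Defs.v *)
From HB Require Import structures.
From mathcomp Require Import all_boot all_order all_algebra.
From mathcomp Require Import complex.
From mathcomp Require Import all_classical all_reals all_analysis.

Set Implicit Arguments.
Unset Strict Implicit.
Unset Printing Implicit Defensive.

Import Order.TTheory GRing.Theory Num.Theory.
Import numFieldNormedType.Exports.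

Local Open Scope classical_set_scope.
Local Open Scope complex_scope.
Local Open Scope ring_scope.

(* [{dot _ for Num.conj}] is linear in its first argument, conjugate-linear in
   the second one, Hermitian and positive definite. *)
Record hilbertType (R : realType) := Hilbert {
  hilbert_sort :> completeNormedModType R[i];
  hdot : {dot hilbert_sort for Num.conj};
  sqr_norm_hdot : forall v : hilbert_sort, `|v| ^+ 2 = hdot v v }.

Definition unitary_operator (R : realType) (H : hilbertType R)
    (u : {linear H -> H}) : Prop :=
  bijective u /\ isometry (hdot H) (hdot H) u.

Record unitary_representation (R : realType) (H : hilbertType R)
    (pi : int -> {linear H -> H}) : Prop := {
  urep_unitary : forall n, unitary_operator (pi n);
  urep0 : forall v, pi 0 v = v;
  urepD : forall m n v, pi (m + n) v = pi m (pi n v) }.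

Definition int_action (T : Type) (alpha : int -> T -> T) : Prop :=
  (forall v, alpha 0 v = v) /\
  (forall m n v, alpha (m + n) v = alpha m (alpha n v)).

Definition affine_map (R : realType) (H : hilbertType R)
    (pi : int -> {linear H -> H}) (b : int -> H) (n : int) (v : H) : H :=
  pi n v + b n.

Definition affine_isometric_action (R : realType) (H : hilbertType R)
    (pi : int -> {linear H -> H}) (b : int -> H) : Prop :=
  unitary_representation pi /\ int_action (affine_map pi b).

Definition bounded_action (R : realType) (H : hilbertType R)
    (alpha : int -> H -> H) : Prop :=
  forall v : H, bounded_set [set alpha n v | n in [set: int]].

(* Norms on [H] take their values in [R[i]], hence the cast of [A]. *)
Definition proper_action (R : realType) (H : hilbertType R)
    (alpha : int -> H -> H) : Prop :=
  exists v : H, forall A : R, exists N : nat,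
    forall n : int, (N <= `|n|)%N -> A%:C <= `|alpha n v|.

Definition subrepresentation (R : realType) (H : hilbertType R)
    (pi : int -> {linear H -> H}) (W : set H) : Prop :=
  GRing.submod_closed [in W] /\ (forall n v, W v -> W (pi n v)).

(* Such a subspace of a normed space is closed, so that closedness does not
   need to be part of [subrepresentation] when both are combined. *)
Definition finite_dimensional (R : realType) (H : hilbertType R)
    (W : set H) : Prop :=
  exists (d : nat) (e : 'I_d -> H),
    W = [set \sum_(i < d) c i *: e i | c in [set: 'I_d -> R[i]]].

(* Main.v *)
Require Import Defs.
From HB Require Import structures.
From Stdlib Require Import PeanoNat.
From mathcomp Require Import all_boot all_order all_algebra.
From mathcomp Require Import complex.
From mathcomp Require Import all_classical all_reals all_analysis.
From mathcomp Require Import ring lra zify.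

(** The action lives on the square summable sequences [l2 R] indexed by [nat]. Read
    through binary digits, an index is a finitely supported sequence of bits, and
    flipping the [j]-th bit defines commuting unitary involutions [tau j]. (In the
    Fourier picture, this is the space of square integrable functions on the Cantor
    group, with [tau j] the multiplication by the [j]-th Rademacher function.)
    Choose roots of unity [c j] of very rapidly growing orders, powers of [2]. The
    generator of the representation is the infinite product [itwist c] of the
    unitaries [twist j (c j)], which multiply the [-1]-eigenspace of [tau j] by
    [c j]; its [n]-th power is the product attached to the sequence [c j ^ n].

    Lacunarity gives, for each [N], a time [h] at which all factors of index below
    [N] have become trivial, the [N]-th one is exactly [tau N], and the later ones
    are still negligible ([lacunary_phases]). So the power [h] is almost [tau N],
    and the power [2 h] is almost the identity.

    No finite-dimensional subrepresentation. A nonzero one would contain an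
    eigenvector ([finite_dim_eigenvector]), hence a vector that is almost an
    eigenvector of every [tau N] ([eigenvector_flip]). But flipping high bits sends
    any coordinate to infinity, so all coordinates vanish ([l2_flip_not_scalar]).

    The cocycle is the formal coboundary of the divergent sum of the indicators
    [F k] of [{0, ..., 2 ^ k - 1}]. As [F k] is fixed by [tau j] for [j < k], the
    representation displaces it very little, and the displacements are summable. At
    the times [2 h] the cocycle is uniformly bounded, so the action is not proper
    ([twist_not_proper]). At the times [h] it is, up to a bounded error, the sum of
    the [tau N (F k) - F k] for [k <= N], whose coordinate of index [0] is
    [- (N + 1)]; so the action is not bounded ([twist_not_bounded]). *)

Set Implicit Arguments.
Unset Strict Implicit.
Unset Printing Implicit Defensive.

Import Order.TTheory GRing.Theory Num.Theory.
Import numFieldNormedType.Exports.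

Local Open Scope classical_set_scope.
Local Open Scope complex_scope.
Local Open Scope ring_scope.

Local Notation Re := complex.Re.
Local Notation Im := complex.Im.

(** * Complex numbers and real-valued norms *)

Section SquaredModulus.
Variable R : realType.
Implicit Types x y : R[i].

Lemma conj_complex x : x^* = Re x -i* Im x.
Proof. by case: x. Qed.

(** Having values in [R], unlike [`|x| ^+ 2], it can be compared, summed and passed
    to the limit with the real-valued theory. *)
Definition sqn x : R := Re x ^+ 2 + Im x ^+ 2.

Lemma sqn_ge0 x : 0 <= sqn x.
Proof. by rewrite addr_ge0 ?sqr_ge0. Qed.

Lemma mul_conj_sqn x : x * x^* = (sqn x)%:C.
Proof. by rewrite -normCK -add_Re2_Im2. Qed.

Lemma sqnM x y : sqn (x * y) = sqn x * sqn y.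
Proof. by case: x y => [a b] [c d]; rewrite /sqn /=; ring. Qed.

Lemma sqnD x y : sqn (x + y) <= 2 * sqn x + 2 * sqn y.
Proof.
case: x y => [a b] [c d]; rewrite /sqn /=.
by have := sqr_ge0 (a - c); have := sqr_ge0 (b - d); lra.
Qed.

Lemma sqn_eq0 x : sqn x = 0 -> x = 0.
Proof.
move=> /eqP; rewrite paddr_eq0 ?sqr_ge0 // !sqrf_eq0 => /andP[/eqP a0 /eqP b0].
by case: x a0 b0 => a b /= -> ->.
Qed.

Lemma posC_real (e : R[i]) : 0 < e -> exists2 r : R, 0 < r & e = r%:C.
Proof.
by exists (Re e); rewrite ?RRe_real ?gtr0_real // -ltcR RRe_real ?gtr0_real.
Qed.

End SquaredModulus.

Section RealNorm.
Variable R : realType.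

(** Norms take values in [R[i]], where the order is only partial; estimates are
    therefore carried out on their real parts. *)
Definition rnorm (V : normedZmodType R[i]) (v : V) : R := Re `|v|.

Section Theory.
Variable V : normedZmodType R[i].
Implicit Types u v w : V.

Lemma rnormE v : `|v| = (rnorm v)%:C.
Proof. by rewrite /rnorm RRe_real // normr_real. Qed.

Lemma rnorm_ge0 v : 0 <= rnorm v.
Proof. by rewrite -ler0c -rnormE. Qed.

Lemma rnorm0 : rnorm (0 : V) = 0.
Proof. by rewrite /rnorm normr0. Qed.

Lemma rnorm_eq0 v : rnorm v = 0 -> v = 0.
Proof. by move=> v0; apply/eqP; rewrite -normr_eq0 rnormE v0. Qed.

Lemma rnormN v : rnorm (- v) = rnorm v.
Proof. by rewrite /rnorm normrN. Qed.

Lemma rdistC v w : rnorm (v - w) = rnorm (w - v).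
Proof. by rewrite /rnorm distrC. Qed.

Lemma rnormD v w : rnorm (v + w) <= rnorm v + rnorm w.
Proof. by rewrite -lecR raddfD /= -!rnormE ler_normD. Qed.

Lemma rnormB v w : rnorm v - rnorm w <= rnorm (v - w).
Proof. by rewrite lerBlDr -{1}(subrK w v) rnormD. Qed.

Lemma rdistD u v w : rnorm (u - w) <= rnorm (u - v) + rnorm (v - w).
Proof. by rewrite (le_trans _ (rnormD _ _)) // addrA subrK. Qed.

End Theory.

Lemma rnormZ (V : normedModType R[i]) (a : R[i]) (v : V) :
  rnorm (a *: v) = rnorm a * rnorm v.
Proof. by apply: complexI; rewrite -rnormE normrZ !rnormE rmorphM. Qed.

Lemma rnormM (a b : R[i]) : rnorm (a * b) = rnorm a * rnorm b.
Proof. by apply: complexI; rewrite -rnormE normrM !rnormE rmorphM. Qed.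

Lemma rnorm_sqr (a : R[i]) : rnorm a ^+ 2 = sqn a.
Proof. by apply: complexI; rewrite rmorphXn /= -rnormE normCK mul_conj_sqn. Qed.

Lemma rnorm1 : rnorm (1 : R[i]) = 1.
Proof. by rewrite /rnorm normr1. Qed.

Lemma rnormV (z : R[i]) : rnorm z^-1 = (rnorm z)^-1.
Proof. by apply: complexI; rewrite -rnormE normfV rnormE fmorphV. Qed.

End RealNorm.

(** * The Hilbert space of square summable sequences *)

Section ComplexSeries.
Variable R : realType.
Implicit Types z w : nat -> R[i].

(** Complex series are handled through their real and imaginary parts, so that
    completeness is only ever used for [R]. *)
Definition has_csum z (l : R[i]) :=
  series (fun i => Re (z i)) @ \oo --> Re l /\
  series (fun i => Im (z i)) @ \oo --> Im l.

Definition csum z : R[i] :=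
  limn (series (fun i => Re (z i))) +i* limn (series (fun i => Im (z i))).

Lemma csum_eq z l : has_csum z l -> csum z = l.
Proof.
by case: l => a b [/= za zb]; congr (_ +i* _); apply: cvg_lim.
Qed.

Lemma cvg_series_lin (f g h : nat -> R) (a b l m : R) :
    (forall i, h i = a * f i + b * g i) ->
    series f @ \oo --> l -> series g @ \oo --> m ->
  series h @ \oo --> a * l + b * m.
Proof.
move=> hE fl gm; have -> : series h = a *: series f + b *: series g.
  apply/funext => n; rewrite !fctE /series /= !scaler_sumr -big_split.
  by apply: eq_bigr => i _; rewrite hE.
by apply: cvgD; apply: cvgZl_tmp.
Qed.

Lemma has_csumD z w l m : has_csum z l -> has_csum w m ->
  has_csum (fun i => z i + w i) (l + m).
Proof.
move=> [zR zI] [wR wI]; rewrite /has_csum !raddfD /=.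
split; [rewrite -[Re l]mul1r -[Re m]mul1r|rewrite -[Im l]mul1r -[Im m]mul1r];
  by apply: cvg_series_lin; eauto => i; rewrite !mul1r raddfD.
Qed.

Lemma has_csumZ a z l : has_csum z l -> has_csum (fun i => a * z i) (a * l).
Proof.
case: a l => [a b] [c d] [/= zR zI]; split => /=.
  rewrite -mulNr; apply: (cvg_series_lin _ zR zI) => i /=.
  by case: (z i) => p q /=; rewrite mulNr.
by apply: (cvg_series_lin _ zI zR) => i /=; case: (z i).
Qed.

Lemma has_csum_conj z l : has_csum z l -> has_csum (fun i => (z i)^* ) l^*.
Proof.
move=> [zR zI]; rewrite conj_complex; split => /=.
  rewrite -[Re l]mul1r -[1 * _]addr0 -[X in _ + X](mul0r (Re l)).
  by apply: cvg_series_lin; eauto => i; rewrite conj_complex /= mul1r mul0r addr0.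
rewrite -[- _]addr0 -mulN1r -[X in _ + X](mul0r (Im l)).
by apply: cvg_series_lin; eauto => i; rewrite conj_complex /= mulN1r mul0r addr0.
Qed.

Definition sq_summable z := cvgn (series (fun i => sqn (z i))).

(** Both parts of [z i * (w i)^* ] are dominated by [|z i|^2 + |w i|^2]. *)
Lemma has_csum_mul_conj z w : sq_summable z -> sq_summable w ->
  has_csum (fun i => z i * (w i)^* ) (csum (fun i => z i * (w i)^* )).
Proof.
move=> zs ws; have bound i : `|Re (z i * (w i)^* )| <= sqn (z i) + sqn (w i) /\
    `|Im (z i * (w i)^* )| <= sqn (z i) + sqn (w i).
  rewrite conj_complex /sqn; case: (z i) (w i) => [a b] [c d] /=.
  rewrite !ler_norml.
  have := sqr_ge0 (a - c); have := sqr_ge0 (b - d).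
  have := sqr_ge0 (a + c); have := sqr_ge0 (b + d).
  have := sqr_ge0 (a - d); have := sqr_ge0 (b - c).
  have := sqr_ge0 (a + d); have := sqr_ge0 (b + c).
  by split; apply/andP; split; lra.
have cv (h : nat -> R) : (forall i, `|h i| <= sqn (z i) + sqn (w i)) ->
    cvgn (series h).
  move=> hb; apply: normed_cvg; apply: series_le_cvg hb _ => //.
    by move=> i; rewrite addr_ge0 ?sqn_ge0.
  exact: is_cvg_seriesD.
by split; apply: cv => i; have [] := bound i.
Qed.

Lemma sq_summableD z w : sq_summable z -> sq_summable w ->
  sq_summable (fun i => z i + w i).
Proof.
move=> zs ws.
apply: (@series_le_cvg _ _ (fun i => 2 * sqn (z i) + 2 * sqn (w i))).
- by move=> i; exact: sqn_ge0.
- by move=> i; rewrite addr_ge0 ?mulr_ge0 ?sqn_ge0.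
- by move=> i; exact: sqnD.
- by apply: is_cvg_seriesD; apply: is_cvg_seriesZ.
Qed.

Lemma sq_summableZ a z : sq_summable z -> sq_summable (fun i => a * z i).
Proof.
move=> zs; rewrite /sq_summable; under eq_fun do rewrite sqnM.
exact: is_cvg_seriesZ.
Qed.

Lemma sq_summable_bounded z (M : R) :
  (forall n, \sum_(i < n) sqn (z i) <= M) -> sq_summable z.
Proof.
move=> bM; apply: nondecreasing_is_cvgn.
  by apply: nondecreasing_series => i _ _; exact: sqn_ge0.
by exists M => _ [n _ <-]; rewrite /series /= big_mkord.
Qed.

End ComplexSeries.

Definition l2_pred (R : realType) : {pred (nat -> R[i])} :=
  fun z => `[< sq_summable z >].

Record l2 (R : realType) := L2 {
  l2val :> nat -> R[i];
  l2valP : l2val \in @l2_pred R }.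

HB.instance Definition _ R := [isSub for @l2val R].
HB.instance Definition _ R := [Choice of l2 R by <:].

Lemma l2_submod_closed (R : realType) : GRing.submod_closed (@l2_pred R).
Proof.
split.
  apply/asboolP; apply: (@sq_summable_bounded _ _ 0) => n.
  by rewrite big1 // => i _; rewrite /sqn /= expr0n /= addr0.
move=> a z w /asboolP zs /asboolP ws; apply/asboolP.
exact: (sq_summableD (sq_summableZ zs) ws).
Qed.

HB.instance Definition _ (R : realType) :=
  GRing.isSubmodClosed.Build _ _ (@l2_pred R) (@l2_submod_closed R).
HB.instance Definition _ (R : realType) :=
  [SubChoice_isSubLmodule of l2 R by <:].

Section L2.
Variable R : realType.
Implicit Types v w : l2 R.

Lemma l2P v : sq_summable v.
Proof. by apply/asboolP; exact: l2valP. Qed.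

Lemma l2_ext v w : v =1 w -> v = w.
Proof. by move=> vw; apply/val_inj/funext. Qed.

Lemma l2_subE v w i : (v - w) i = v i - w i.
Proof. by []. Qed.

Definition l2dot v w : R[i] := csum (fun i => v i * (w i)^* ).

Lemma l2dot_csum v w : has_csum (fun i => v i * (w i)^* ) (l2dot v w).
Proof. by apply: has_csum_mul_conj; exact: l2P. Qed.

Lemma l2dotC v w : l2dot v w = (l2dot w v)^*.
Proof.
apply: csum_eq; have := has_csum_conj (l2dot_csum w v).
by under eq_fun do rewrite rmorphM /= conjCK mulrC.
Qed.

Lemma l2dotDZ a u v w : l2dot (a *: u + v) w = a * l2dot u w + l2dot v w.
Proof.
apply: csum_eq.
have := has_csumD (has_csumZ a (l2dot_csum u w)) (l2dot_csum v w).
by under eq_fun do rewrite mulrA -mulrDl.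
Qed.

Lemma l2dot_bilinear : bilinear_for
  ( *%R : GRing.Scale.law R[i] R[i])
  (Num.conj \; *%R : GRing.Scale.law R[i] R[i]) l2dot.
Proof.
split=> [u a v w|u a v w] /=; first by rewrite l2dotDZ.
by rewrite l2dotC l2dotDZ rmorphD rmorphM /= -!l2dotC.
Qed.

HB.instance Definition _ :=
  @bilinear_isBilinear.Build _ _ _ _ _ _ l2dot l2dot_bilinear.

Lemma l2dot_herm v w : l2dot v w = (-1) ^+ false * (l2dot w v)^*.
Proof. by rewrite expr0 mul1r -l2dotC. Qed.

HB.instance Definition _ := isHermitianSesquilinear.Build _ _ false
  (@Num.conj R[i]) l2dot l2dot_herm.

Definition l2sq v : R := limn (series (fun i => sqn (v i))).

Lemma l2dotE v : l2dot v v = (l2sq v)%:C.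
Proof.
apply: csum_eq; split => /=.
  by under eq_fun do rewrite mul_conj_sqn; exact: l2P.
under eq_fun do rewrite mul_conj_sqn /=.
have -> : series (fun=> 0 : R) = fun=> 0.
  by apply/funext => n; rewrite /series /= big1.
exact: cvg_cst.
Qed.

Lemma l2sq_ge v n : \sum_(i < n) sqn (v i) <= l2sq v.
Proof.
rewrite -(big_mkord xpredT (fun i => sqn (v i))).
apply: (@nondecreasing_cvgn_le _ (series (fun i => sqn (v i)))).
  by apply: nondecreasing_series => i _ _; exact: sqn_ge0.
exact: l2P.
Qed.

Lemma l2sq_le v (M : R) : (forall n, \sum_(i < n) sqn (v i) <= M) -> l2sq v <= M.
Proof.
move=> bM; apply: limr_le; first exact: l2P.
by apply: nearW => n; rewrite /series /= big_mkord.
Qed.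

Lemma sqn_le_l2sq v i : sqn (v i) <= l2sq v.
Proof.
apply: le_trans (l2sq_ge v i.+1); rewrite big_ord_recr /= lerDr.
by apply: sumr_ge0 => j _; exact: sqn_ge0.
Qed.

Lemma l2dot_gt0 v : v != 0 -> 0 < l2dot v v.
Proof.
move=> v0; rewrite l2dotE ltcR lt_neqAle (le_trans (sqn_ge0 _) (sqn_le_l2sq v 0)).
rewrite andbT eq_sym; apply: contra v0 => /eqP vs; apply/eqP/l2_ext => i.
by apply/sqn_eq0/le_anti; rewrite sqn_ge0 -vs sqn_le_l2sq.
Qed.

HB.instance Definition _ := isDotProduct.Build _ _ l2dot l2dot_gt0.
End L2.

(** The squared norm of [u - (f u v / f v v) *: v], the part of [u] orthogonal to
    [v], is nonnegative; no dimension is assumed finite. *)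
Lemma dot_CauchySchwarz (C : numClosedFieldType) (U : lmodType C)
    (f : {dot U for Num.conj}) (u v : U) : `|f u v| ^+ 2 <= f u u * f v v.
Proof.
have [->|v0] := eqVneq v 0.
  by rewrite !linear0r normr0 expr0n.
have fv0 : 0 < f v v by rewrite dnorm_gt0.
have fvC : (f v v)^* = f v v by apply/CrealP/gtr0_real.
rewrite -subr_ge0.
have := mulr_ge0 (dnorm_ge0 f (u - (f u v / f v v) *: v)) (ltW fv0).
rewrite dnormB dnormZ linearZr_LR /= !normCK !(rmorphM, fmorphV) /= conjCK fvC.
rewrite fvC; congr (0 <= _); field.
by rewrite gt_eqF.
Qed.

Section L2norm.
Variable R : realType.
Implicit Types v w : l2 R.

Lemma l2sq_ge0 v : 0 <= l2sq v.
Proof. exact: le_trans (sqn_ge0 _) (sqn_le_l2sq v 0). Qed.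

Definition l2norm v : R[i] := (Num.sqrt (l2sq v))%:C.

Lemma l2norm_sqr v : l2norm v ^+ 2 = l2dot v v.
Proof. by rewrite -rmorphXn /= sqr_sqrtr ?l2sq_ge0 // l2dotE. Qed.

Lemma l2norm_ge0 v : 0 <= l2norm v.
Proof. by rewrite ler0c sqrtr_ge0. Qed.

Lemma l2norm_triangle v w : l2norm (v + w) <= l2norm v + l2norm w.
Proof.
rewrite -(@ler_pXn2r _ 2) ?nnegrE ?addr_ge0 ?l2norm_ge0 //.
rewrite sqrrD !l2norm_sqr (dnormD (@l2dot R)) addrAC lerD2r lerD2l //=.
set d := l2dot v w; set p := l2norm v * l2norm w.
have dp : `|d| <= p.
  rewrite -(@ler_pXn2r _ 2) ?nnegrE ?mulr_ge0 ?l2norm_ge0 //.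
  by rewrite exprMn !l2norm_sqr dot_CauchySchwarz.
by rewrite mulr2n (le_trans (real_ler_norm _)) ?CrealE ?rmorphD /= ?conjCK
  1?addrC // (le_trans (ler_normD _ _)) // norm_conjC lerD.
Qed.

Lemma l2normZ a v : l2norm (a *: v) = `|a| * l2norm v.
Proof.
apply/eqP; rewrite -(@eqrXn2 _ 2) ?mulr_ge0 ?l2norm_ge0 //.
by rewrite exprMn !l2norm_sqr -(dnormZ (@l2dot R)).
Qed.

Lemma l2norm_eq0 v : l2norm v = 0 -> v = 0.
Proof.
move=> v0; apply/eqP; rewrite -(dnorm_eq0 (@l2dot R)) /=.
by rewrite -l2norm_sqr v0 expr0n.
Qed.

HB.instance Definition _ :=
  Lmodule_isNormed.Build R[i] (l2 R) l2norm_triangle l2normZ l2norm_eq0.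

Lemma l2_rnorm v : rnorm v = Num.sqrt (l2sq v).
Proof. by []. Qed.

Lemma l2_rnorm_sqr v : rnorm v ^+ 2 = l2sq v.
Proof. by rewrite l2_rnorm sqr_sqrtr ?l2sq_ge0. Qed.

Lemma rnorm_coord v i : rnorm (v i) <= rnorm v.
Proof.
rewrite -(@ler_pXn2r _ 2) ?nnegrE ?rnorm_ge0 // rnorm_sqr l2_rnorm_sqr.
exact: sqn_le_l2sq.
Qed.

End L2norm.

Section L2complete.
Variable R : realType.

(** The candidate limit [l] is the coordinatewise one. Finite partial sums of
    [|x - l|^2] are controlled by comparing with some [y] close to [x] in norm and
    to [l] on finitely many coordinates; this shows at once that [l] is square
    summable and that it is the limit in norm. *)
Lemma l2_complete (F : set_system (l2 R)) : ProperFilter F -> cauchy F -> cvg F.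
Proof.
move=> FF /cauchyP Fc.
have FcR (e : R) : 0 < e -> exists x, F [set y | rnorm (x - y) < e].
  move=> e0; have [|x Fx] := Fc e%:C; first by rewrite ltcR.
  exists x; apply: filterS Fx => y.
  by rewrite -ball_normE /ball_ /= rnormE ltcR.
(* The real and imaginary parts of the coordinates are 1-Lipschitz, hence
   converge along [F]. *)
have lim_lip (f : l2 R -> R) : (forall v w, `|f v - f w| <= rnorm (v - w)) ->
    cvg (f @ F).
  move=> flip; apply: R_complete; apply/cauchyP => e e0.
  have [x Fx] := FcR e e0; exists (f x).
  rewrite /fmap /=; apply: filterS Fx => y xy.
  by rewrite /= -ball_normE /ball_ /= (le_lt_trans (flip _ _)).
have Re_lip i (v w : l2 R) : `|Re (v i) - Re (w i)| <= rnorm (v - w).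
  apply: le_trans (rnorm_coord (v - w) i); rewrite l2_subE -raddfB -lecR.
  by rewrite -rnormE normc_ge_Re.
have Im_lip i (v w : l2 R) : `|Im (v i) - Im (w i)| <= rnorm (v - w).
  apply: le_trans (rnorm_coord (v - w) i); rewrite l2_subE -raddfB /=.
  rewrite -(@ler_pXn2r _ 2) ?nnegrE ?rnorm_ge0 // rnorm_sqr.
  rewrite real_normK ?num_real //.
  by rewrite lerDr sqr_ge0.
have lim_coord i : exists l : R[i], forall e : R, 0 < e ->
    F [set y : l2 R | sqn (y i - l) < e].
  have /cvgrPdist_lt cR := lim_lip _ (Re_lip i).
  have /cvgrPdist_lt cI := lim_lip _ (Im_lip i).
  exists (lim (Re (v i) @[v --> F]) +i* lim (Im (v i) @[v --> F])) => e e0.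
  have [d [d0 d1 de]] : exists d, [/\ 0 < d, d <= 1 & 2 * d <= e :> R].
    exists (Num.min 1 (e / 2)); rewrite lt_min ltr01 divr_gt0 //= ge_min lexx.
    by split=> //; rewrite mulrC -ler_pdivlMr // ge_min lexx orbT.
  apply: filterS2 (cR d d0) (cI d d0) => y /= yR yI.
  rewrite /sqn !raddfB /= -![Re _ - _]opprB -![Im _ - _]opprB !sqrrN.
  rewrite -[X in X + _]real_normK ?num_real //.
  rewrite -[X in _ + X]real_normK ?num_real //.
  move: yR yI; set s := `|_|; set t := `|_| => sd td.
  have s0 : 0 <= s by exact: normr_ge0.
  have t0 : 0 <= t by exact: normr_ge0.
  by nra.
have [l Fl] := choice lim_coord.
(* The inequality |a + b|^2 <= 2|a|^2 + 2|b|^2 accounts for the factor 2. *)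
have close e : 0 < e -> exists x : l2 R, F [set y | rnorm (x - y) < e] /\
    forall n, \sum_(i < n) sqn (x i - l i) <= (2 * e) ^+ 2.
  move=> e0; have [x Fx] := FcR e e0; exists x; split => // n.
  have d0 : 0 < e ^+ 2 / n.+1%:R by rewrite divr_gt0 ?exprn_gt0.
  have Fn : F [set y : l2 R |
      forall i : 'I_n, sqn (y i - l i) < e ^+ 2 / n.+1%:R].
    by apply: filter_forall => i; exact: Fl.
  have [y [xy yl]] := filter_ex (filterI Fx Fn).
  apply: (@le_trans _ _ (2 * \sum_(i < n) sqn ((x - y) i) +
                         2 * \sum_(i < n) sqn (y i - l i))).
    rewrite !mulr_sumr -big_split /=; apply: ler_sum => i _.
    by rewrite -(subrKA (y i)) sqnD.
  have xy2 : \sum_(i < n) sqn ((x - y) i) <= e ^+ 2.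
    apply: le_trans (l2sq_ge _ _) _; rewrite -l2_rnorm_sqr.
    by rewrite ler_pXn2r ?nnegrE ?rnorm_ge0 ?ltW.
  have yl2 : \sum_(i < n) sqn (y i - l i) <= e ^+ 2.
    apply: (@le_trans _ _ (\sum_(i < n) (e ^+ 2 / n.+1%:R))).
      by apply: ler_sum => i _; exact/ltW/yl.
    rewrite sumr_const card_ord -[_ *+ n]mulr_natr mulrAC ler_pdivrMr //.
    by rewrite ler_wpM2l ?sqr_ge0 // ler_nat.
  rewrite exprMn; lra.
have ls : l \in @l2_pred R.
  have [x [_ xl]] := close 1 ltr01.
  apply/asboolP; have := sq_summableD (@l2P _ x)
    (sq_summableZ (a := -1) (@sq_summable_bounded _ (fun i => x i - l i) _ xl)).
  by under [X in sq_summable X]eq_fun do rewrite mulN1r opprB addrC subrK.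
apply/cvg_ex; exists (L2 ls); apply/cvgrPdist_le => e e0.
have [r r0 ->] := posC_real e0.
have [|x [Fx xl]] := close (r / 3); first by rewrite divr_gt0.
apply: filterS Fx => y /= xy; rewrite rnormE lecR.
apply: le_trans (rdistD _ x _) _.
have : rnorm (L2 ls - x) <= 2 * (r / 3).
  rewrite rdistC -(@ler_pXn2r _ 2) ?nnegrE ?rnorm_ge0 ?mulr_ge0
    ?divr_ge0 ?(ltW r0) //.
  by rewrite l2_rnorm_sqr; apply: l2sq_le.
by move: xy; lra.
Qed.

HB.instance Definition _ := Uniform_isComplete.Build (l2 R) l2_complete.

Definition l2_hilbert : hilbertType R :=
  @Hilbert R (l2 R) (@l2dot R) (@l2norm_sqr R).

End L2complete.

(** * Limits and isometries in a Hilbert space *)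

Section HilbertSpace.
Variables (R : realType) (H : hilbertType R).
Implicit Types (u : nat -> H) (x y : H).

Lemma cvg_rnormP u y : u @ \oo --> y <->
  forall e : R, 0 < e -> \forall n \near \oo, rnorm (y - u n) <= e.
Proof.
split=> [/cvgrPdist_le uy e e0|uy].
  by near=> n; rewrite -lecR -rnormE; near: n; apply: uy; rewrite ltcR.
apply/cvgrPdist_le => e e0.
have [r r0 ->] := posC_real e0.
by near=> n; rewrite rnormE lecR; near: n; exact: uy.
Unshelve. all: by end_near. Qed.

Lemma rnorm_lim_le u y x (N : nat) (e : R) : u @ \oo --> y ->
  (forall n, (N <= n)%N -> rnorm (u n - x) <= e) -> rnorm (y - x) <= e.
Proof.
move=> /cvg_rnormP uy ux; apply/ler_addgt0Pr => d d0.
have [n [un Nn]] := filter_ex (filterI (uy d d0) (nbhs_infty_ge N)).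
by apply: (le_trans (rdistD _ (u n) _)); rewrite [e + d]addrC lerD // ux.
Qed.

Lemma half_pow_small (c e : R) : 0 < e -> exists n : nat, c / 2 ^+ n < e.
Proof.
move=> e0; have [n cn] : exists n : nat, c / e < n%:R.
  exists (Num.bound `|c / e|).
  exact: le_lt_trans (ler_norm _) (archi_boundP (normr_ge0 _)).
exists n; rewrite ltr_pdivrMr ?exprn_gt0 // mulrC -ltr_pdivrMr //.
by rewrite (lt_le_trans cn) // -natrX ler_nat ltnW // ltn_expl.
Qed.

(** The form in which completeness is used: the estimate of the limit is read off
    from any index [K] past which the increments are geometrically small. *)
Lemma geometric_cvg u (K : nat) (c : R) :
    (forall n, (K <= n)%N -> rnorm (u n.+1 - u n) <= c / 2 ^+ n) ->
  cvg (u @ \oo) /\ rnorm (lim (u @ \oo) - u K) <= 2 * c / 2 ^+ K.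
Proof.
move=> uc.
have c0 : 0 <= c.
  have := le_trans (rnorm_ge0 _) (uc K (leqnn K)).
  by rewrite pmulr_lge0 // invr_gt0 exprn_gt0.
have uD n k : (K <= n)%N ->
    rnorm (u (n + k)%N - u n) <= 2 * c / 2 ^+ n - 2 * c / 2 ^+ (n + k).
  move=> Kn; elim: k => [|k IH]; first by rewrite addn0 !subrr rnorm0.
  rewrite addnS; apply: le_trans (rdistD _ (u (n + k)%N) _) _.
  have -> : 2 * c / 2 ^+ n - 2 * c / 2 ^+ (n + k).+1 =
     c / 2 ^+ (n + k) + (2 * c / 2 ^+ n - 2 * c / 2 ^+ (n + k)).
    rewrite !exprS !exprD; field.
    by rewrite !expf_neq0 ?pnatr_eq0.
  by apply: lerD IH; apply: uc; rewrite (leq_trans Kn) ?leq_addr.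
have ule n m : (K <= n)%N -> (n <= m)%N -> rnorm (u m - u n) <= 2 * c / 2 ^+ n.
  move=> Kn /subnKC <-; apply: le_trans (uD _ _ Kn) _.
  by rewrite gerBl divr_ge0 ?mulr_ge0 ?exprn_ge0.
have ucv : cvg (u @ \oo).
  apply: cauchy_cvg; apply: cauchy_exP => e e0.
  have [r r0 ->] := posC_real e0.
  have [n nr] := half_pow_small (2 * c) r0.
  exists (u (maxn K n)); rewrite /fmap /=; near=> m => /=.
  rewrite -ball_normE /ball_ /= rnormE ltcR rdistC.
  apply: le_lt_trans (ule _ _ (leq_maxl _ _) _) _.
    by near: m; exact: nbhs_infty_ge.
  apply: le_lt_trans nr; rewrite ler_wpM2l ?mulr_ge0 //.
  by rewrite lef_pV2 ?posrE ?exprn_gt0 // ler_weXn2l ?leq_maxr // ler1n.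
split=> //; apply: (rnorm_lim_le ucv (N := K)) => n Kn.
exact: ule.
Unshelve. all: by end_near. Qed.

Lemma hilbert_cvg_unique u x y : u @ \oo --> x -> u @ \oo --> y -> x = y.
Proof. by move=> ux uy; apply: (cvg_unique (@norm_hausdorff _ H) ux uy). Qed.

Lemma rnorm_isometry (f : H -> H) :
  (forall v, hdot H (f v) (f v) = hdot H v v) ->
  forall v, rnorm (f v) = rnorm v.
Proof.
move=> f_iso v; apply/eqP; rewrite -(@eqrXn2 _ 2) ?rnorm_ge0 //; apply/eqP.
by apply: complexI; rewrite !rmorphXn /= -!rnormE !sqr_norm_hdot f_iso.
Qed.

(** Polarization: the norms of [x + y] and of ['i *: x + y] determine the real and
    the imaginary part of the inner product of [x] and [y]. *)
Lemma isometry_of_rnorm (f : {linear H -> H}) :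
  (forall v, rnorm (f v) = rnorm v) -> isometry (hdot H) (hdot H) f.
Proof.
move=> f_norm; have f_iso v : hdot H (f v) (f v) = hdot H v v.
  by rewrite -!sqr_norm_hdot !rnormE f_norm.
have re x y : hdot H (f x) (f y) + (hdot H (f x) (f y))^* =
    hdot H x y + (hdot H x y)^*.
  by have := f_iso (x + y); rewrite linearD !dnormD !f_iso => /addrI.
move=> x y; have := re x y; have := re ('i *: x) y.
rewrite linearZ !linearZl_LR /= !rmorphM /= conjCi.
set p := hdot H _ _; set q := hdot H _ _; set p' := p^*; set q' := q^*.
rewrite !mulNr -!mulrBr => /(mulfI (neq0Ci _)) im rl.
have : 2 * p = 2 * q.
  have -> : 2 * p = (p - p') + (p + p') by ring.
  by rewrite im rl; ring.
by apply: mulfI; rewrite pnatr_eq0.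
Qed.

End HilbertSpace.

(** * Lacunary sequences of roots of unity *)

Section RootsOfUnity.
Variable R : realType.

(** With [0 <= Re w] one has [|w + 1|^2 >= 2], and [z - 1 = (w - 1) * (w + 1)]. *)
Lemma unimodular_sqrt (z : R[i]) : rnorm z = 1 -> exists w : R[i],
  [/\ w ^+ 2 = z, rnorm w = 1 & 2 * sqn (w - 1) <= sqn (z - 1)].
Proof.
move=> z1; have [w w2 w0] : exists2 w : R[i], w ^+ 2 = z & 0 <= Re w.
  have [s0|s0] := leP 0 (Re (sqrtC z)).
    by exists (sqrtC z); rewrite ?sqrtCK.
  by exists (- sqrtC z); rewrite ?sqrrN ?sqrtCK // raddfN oppr_ge0 ltW.
have w1 : sqn w = 1.
  have : sqn w ^+ 2 = 1 by rewrite expr2 -sqnM -expr2 w2 -rnorm_sqr z1 expr1n.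
  move/eqP; rewrite sqrf_eq1 => /orP[/eqP //|/eqP wN].
  by have := sqn_ge0 w; rewrite wN; lra.
exists w; split => //.
  by apply/eqP; rewrite -(@eqrXn2 _ 2) ?rnorm_ge0 // rnorm_sqr w1 expr1n.
have -> : z - 1 = (w - 1) * (w + 1) by rewrite -w2; ring.
rewrite sqnM mulrC ler_wpM2l ?sqn_ge0 //.
by move: w0 w1; rewrite /sqn; case: (w) => a b /=; nra.
Qed.

(** Iterated square roots of [-1]: [zeta n] is a primitive root of unity of order
    [2 ^ n], and it tends to [1] geometrically. *)
Lemma dyadic_roots : exists zeta : nat -> R[i],
  [/\ zeta 0 = 1, zeta 1 = -1, forall n, zeta n.+1 ^+ 2 = zeta n,
      forall n, rnorm (zeta n) = 1 & forall n, 2 ^+ n * sqn (zeta n - 1) <= 8].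
Proof.
have /choice [h hP] : forall z : R[i], exists w : R[i], rnorm z = 1 ->
    [/\ w ^+ 2 = z, rnorm w = 1 & 2 * sqn (w - 1) <= sqn (z - 1)].
  move=> z; have [z1|z1] := eqVneq (rnorm z) 1.
    by have [w wP] := unimodular_sqrt z1; exists w.
  by exists 0 => zE; rewrite zE eqxx in z1.
pose zeta n := if n is m.+1 then iter m h (-1) else 1.
have z1 n : rnorm (zeta n.+1) = 1.
  elim: n => [|n IH]; first by rewrite /zeta /= rnormN rnorm1.
  by have [] := hP _ IH.
exists zeta; split=> //.
- by case=> [|n]; [rewrite /zeta /= sqrrN expr1n|have [] := hP _ (z1 n)].
- by case=> [|n]; [exact: rnorm1|exact: z1].
- case=> [|n]; first by rewrite subrr /sqn /= expr0n /= addr0 mulr0.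
  elim: n => [|n IH].
    by rewrite expr1 /sqn /=; lra.
  have [_ _ le] := hP _ (z1 n); apply: le_trans IH.
  by rewrite [2 ^+ n.+2]exprSr -mulrA ler_wpM2l ?exprn_ge0.
Qed.

End RootsOfUnity.

Section Phases.
Variable R : realType.
Implicit Types (a b : nat -> R[i]).

(** The rate [4 ^- j] beats the growth [2 ^+ k] allowed below to the vectors
    [F k] whose formal sum defines the cocycle. *)
Definition phase (B : R) a :=
  (forall j, rnorm (a j) = 1) /\ (forall j, rnorm (a j - 1) <= B / 4 ^+ j).

Lemma rnorm_expz (z : R[i]) (n : int) : rnorm z = 1 -> rnorm (z ^ n) = 1.
Proof.
move=> z1; have zX m : rnorm (z ^+ m) = 1.
  by elim: m => [|m IH]; rewrite ?rnorm1 // exprS rnormM z1 mul1r.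
case: n => m; first exact: zX.
by rewrite NegzE -exprnN rnormV zX invr1.
Qed.

Lemma rnorm_expz_sub1 (z : R[i]) (n : int) : rnorm z = 1 ->
  rnorm (z ^ n - 1) <= `|n|%N%:R * rnorm (z - 1).
Proof.
move=> z1; have zX (m : nat) : rnorm (z ^ m - 1) <= m%:R * rnorm (z - 1).
  elim: m => [|m IH]; first by rewrite expr0z subrr rnorm0 mul0r.
  have -> : z ^ m.+1 - 1 = z ^ m * (z - 1) + (z ^ m - 1).
    by rewrite -exprnP exprSr exprnP; ring.
  apply: le_trans (rnormD _ _) _.
  by rewrite rnormM rnorm_expz // mul1r -natr1 mulrDl mul1r addrC lerD.
have z0 : z != 0 by apply/eqP => z0; move: z1; rewrite z0 rnorm0; lra.
case: n => m; first exact: zX.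
rewrite NegzE abszN -exprnN exprnP (_ : _ - 1 = (z ^ m.+1)^-1 * (1 - z ^ m.+1)).
  by rewrite rnormM rnormV rnorm_expz // invr1 mul1r rdistC.
by rewrite mulrBr mulr1 mulVf ?expfz_neq0.
Qed.

Lemma phase_ge0 B a : phase B a -> 0 <= B.
Proof. by case=> _ /(_ 0); rewrite divr1; exact/le_trans/rnorm_ge0. Qed.

Lemma phaseM A B a b : phase A a -> phase B b ->
  phase (A + B) (fun j => a j * b j).
Proof.
move=> [a1 aA] [b1 bB]; split=> j; first by rewrite rnormM a1 b1 mulr1.
have -> : a j * b j - 1 = (a j - 1) + a j * (b j - 1) by ring.
by apply: le_trans (rnormD _ _) _; rewrite rnormM a1 mul1r mulrDl lerD.
Qed.

Lemma phase_pow B a (n : int) : phase B a ->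
  phase (`|n|%N%:R * B) (fun j => a j ^ n).
Proof.
move=> [a1 aB]; split=> j; first exact: rnorm_expz.
by apply: le_trans (rnorm_expz_sub1 _ (a1 j)) _; rewrite -mulrA ler_wpM2l.
Qed.

(** The time [h] isolates the [N]-th reflection, and the time [2 h] is an
    approximate return to the identity. The errors obey the bound of [phase 3],
    uniformly in [N]: this is what keeps the cocycle bounded at the times [2 h]. *)
Definition lacunary (c : nat -> R[i]) := forall N, exists h : nat,
  [/\ (N <= h)%N, forall j, (j < N)%N -> c j ^+ h = 1, c N ^+ h = -1 &
      forall j, (N < j)%N -> rnorm (c j ^+ h - 1) <= 3 / 4 ^+ j /\
        rnorm (c j ^+ h.*2 - 1) <= 3 / 4 ^+ j].

(** Roots of unity of orders [2 ^ A j], where [A] has increasing gaps. *)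
Lemma lacunary_phases : exists2 c : nat -> R[i], phase 3 c & lacunary c.
Proof.
have [z [z0 z1 zS zn zB]] := dyadic_roots R.
have zX n k : z (n + k)%N ^+ (2 ^ k) = z n.
  elim: k => [|k IH]; first by rewrite addn0 expn0 expr1.
  by rewrite addnS expnS exprM zS IH.
have z_near n j : (4 * j <= n)%N -> rnorm (z n - 1) <= 3 / 4 ^+ j.
  move=> jn; rewrite -(@ler_pXn2r _ 2) ?nnegrE ?rnorm_ge0 ?divr_ge0 ?exprn_ge0 //.
  rewrite rnorm_sqr exprMn exprVn -exprM ler_pdivlMr ?exprn_gt0 // mulrC.
  have le : 4 ^+ (j * 2) <= 2 ^+ n :> R.
    by rewrite (_ : 4 = 2 ^+ 2 :> R) -?exprM ?ler_weXn2l ?ler1n //; [lia|ring].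
  have := le_trans (ler_wpM2r (sqn_ge0 _) le) (zB n); lra.
(* Consecutive values of [A] differ by [4 j], enough for the phases of index [j]
   to be within [3 / 4 ^+ j] of [1] at the times attached to [N < j]. *)
pose A j := (2 * (j * j + j) + 2)%N.
have Alt N j : (N < j)%N -> (A N + 4 * j <= A j)%N.
  by move=> Nj; rewrite /A; nia.
exists (fun j => z (A j)).
  by split=> j; [exact: zn|apply: z_near; rewrite /A; case: j => // j; nia].
move=> N; exists (2 ^ (A N).-1)%N.
have z_one n k : (n <= k)%N -> z n ^+ (2 ^ k) = 1.
  by move=> nk; rewrite -(subnK nk) expnD mulnC exprM -{1}[n]add0n zX z0 expr1n.
split=> [|j jN||j Nj].
- by apply: (leq_trans _ (ltnW (ltn_expl _ _))) => //; rewrite /A; nia.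
- by apply: z_one; rewrite /A; nia.
- have AN : A N = (1 + (A N).-1)%N by rewrite /A; lia.
  by rewrite {1}AN zX.
- have AE k : (k <= A j)%N -> z (A j) ^+ (2 ^ k) = z (A j - k)%N.
    by move=> kA; rewrite -{1}(subnK kA) zX.
  have AN := Alt N j Nj; have AN0 : (0 < A N)%N by rewrite /A; lia.
  split; first by rewrite AE; [apply: z_near; lia|lia].
  by rewrite -mul2n -expnS prednK // AE; [apply: z_near; lia|lia].
Qed.

Definition flip_phase N : nat -> R[i] := fun j => if j == N then -1 else 1.

Lemma phase_flip N : phase (2 * 4 ^+ N) (flip_phase N).
Proof.
split=> j; rewrite /flip_phase; case: eqP => [jN|_].
- by rewrite rnormN rnorm1.
- exact: rnorm1.
- rewrite jN mulfK ?expf_neq0 ?pnatr_eq0 // -opprD rnormN.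
  by rewrite /rnorm ger0_norm ?addr_ge0.
- by rewrite subrr rnorm0 divr_ge0 ?mulr_ge0 ?exprn_ge0.
Qed.

Variable c : nat -> R[i].
Hypothesis c_phase : phase 3 c.

Definition pows (n : int) : nat -> R[i] := fun j => c j ^ n.

Lemma pows_phase n : phase (`|n|%N%:R * 3) (pows n).
Proof. exact: phase_pow c_phase. Qed.

Lemma powsD m n : pows (m + n) = fun j => pows m j * pows n j.
Proof.
apply/funext => j; rewrite /pows expfzDr //; apply/eqP => c0.
by have := c_phase.1 j; rewrite c0 rnorm0; lra.
Qed.

Hypothesis c_lacunary : lacunary c.

Lemma phase_pows_double N : exists h : nat, (N <= h)%N /\ phase 3 (pows h.*2).
Proof.
have [h [Nh hlt hN hgt]] := c_lacunary N; exists h; split=> //.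
split=> j; first by rewrite /pows rnorm_expz ?c_phase.1.
rewrite /pows -exprnP; case: (ltngtP j N) => [jN|/hgt[] //|->].
  by rewrite -muln2 exprM hlt // expr1n subrr rnorm0 divr_ge0 ?exprn_ge0.
by rewrite -muln2 exprM hN sqrrN expr1n subrr rnorm0 divr_ge0 ?exprn_ge0.
Qed.

(** The factor [a] is the small perturbation of the exact sign flip. *)
Lemma pows_half N : exists (h : nat) (a : nat -> R[i]), [/\ phase 3 a,
    forall j, (j <= N)%N -> a j = 1 &
    pows h = fun j => a j * flip_phase N j].
Proof.
have [h [Nh hlt hN hgt]] := c_lacunary N.
pose a j := pows h j * flip_phase N j.
have a1 j : (j <= N)%N -> a j = 1.
  rewrite leq_eqVlt /a /pows /flip_phase -exprnP => /predU1P[->|jN].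
    by rewrite eqxx hN mulrNN mulr1.
  by rewrite ltn_eqF // hlt // mulr1.
exists h, a; split=> //; last first.
  apply/funext => j; rewrite /a -mulrA /flip_phase.
  by case: eqP; rewrite ?mulrNN !mulr1.
split=> j.
  by rewrite /a rnormM /pows rnorm_expz ?c_phase.1 // (phase_flip _).1 mulr1.
have [jN|Nj] := leqP j N; first by rewrite a1 // subrr rnorm0 divr_ge0 ?exprn_ge0.
by rewrite /a /flip_phase gtn_eqF // mulr1 /pows -exprnP; have [] := hgt j Nj.
Qed.

End Phases.

(** * Twisting by commuting reflections *)

Section Reflections.
Variables (R : realType) (H : hilbertType R) (tau : nat -> {linear H -> H}).
Hypothesis tau_iso : forall j, isometry (hdot H) (hdot H) (tau j).
Hypothesis tauK : forall j v, tau j (tau j v) = v.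
Hypothesis tauC : forall i j v, tau i (tau j v) = tau j (tau i v).
Implicit Types (v w : H) (c d : R[i]) (a b : nat -> R[i]).

(** The unitary equal to [c] on the [-1]-eigenspace of the involution [tau j] and
    to the identity on its [1]-eigenspace. *)
Definition twist j c : {linear H -> H} :=
  idfun \+ ((c - 1) / 2) \*: (idfun \- tau j).

Arguments twist : simpl never.

Lemma twistE j c v : twist j c v = v + ((c - 1) / 2) *: (v - tau j v).
Proof. by []. Qed.

Lemma twist1 j v : twist j 1 v = v.
Proof. by rewrite twistE subrr mul0r scale0r addr0. Qed.

Lemma twistN1 j v : twist j (-1) v = tau j v.
Proof.
rewrite twistE (_ : (-1 - 1) / 2 = -1); last by field.
by rewrite scaleN1r opprB addrC subrK.
Qed.

Lemma twist_fixed j c v : tau j v = v -> twist j c v = v.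
Proof. by move=> tv; rewrite twistE tv subrr scaler0 addr0. Qed.

Lemma tau_twist i j c v :
  tau i (twist j c v) = tau i v + ((c - 1) / 2) *: (tau i v - tau i (tau j v)).
Proof. by rewrite twistE linearD linearZ linearB. Qed.

Lemma twistM j c d v : twist j (c * d) v = twist j c (twist j d v).
Proof.
rewrite [RHS]twistE tau_twist tauK !twistE.
rewrite -[tau j v - v]opprB; set x := v - tau j v.
have -> : v + ((d - 1) / 2) *: x - (tau j v + ((d - 1) / 2) *: - x) = d *: x.
  rewrite scalerN opprD opprK addrACA -/x -scalerDl -{1}[x]scale1r -scalerDl.
  by congr (_ *: _); field.
by rewrite scalerA -addrA -scalerDl; congr (_ + _ *: _); field.
Qed.

Lemma twistC i j c d v : twist i c (twist j d v) = twist j d (twist i c v).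
Proof.
rewrite [RHS]twistE [twist j d v]twistE linearD linearZ linearB.
by congr (_ + _ *: (_ - _)); rewrite tau_twist tauC -twistE.
Qed.

(** [v - tau j v] is twice the orthogonal projection of [v] on the [-1]-eigenspace,
    which [twist j c] multiplies by the unimodular [c]. *)
Lemma rnorm_twist j c v : rnorm c = 1 -> rnorm (twist j c v) = rnorm v.
Proof.
move=> c1; apply: rnorm_isometry => {}v; rewrite twistE.
set x := v - tau j v; set s := hdot H v x.
have tC : (hdot H v (tau j v))^* = hdot H v (tau j v).
  have := hermC (hdot H) (tau j v) v; rewrite expr0 mul1r /= => <-.
  by rewrite -[RHS](tau_iso j) tauK.
have ss : s^* = s.
  rewrite /s /x linearBr /= rmorphB /= tC -!sqr_norm_hdot rmorphXn /=.
  by rewrite (CrealP (normr_real _)).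
have xx : hdot H x x = 2 * s.
  rewrite /s /x dnormB tau_iso tC linearBr /=; ring.
have cc : c * c^* = 1 by rewrite -normCK rnormE c1 expr1n.
set g := (c - 1) / 2.
have gC : g^* = (c^* - 1) / 2.
  by rewrite rmorphM fmorphV rmorphB /= rmorph1 rmorph_nat.
rewrite dnormD dnormZ linearZr_LR /= xx -/s normCK.
move: g gC (erefl g : g = (c - 1) / 2) => g gC gE.
rewrite rmorphM /= conjCK ss gC gE.
rewrite -[RHS]addr0 -addrA; congr (_ + _).
rewrite (_ : _ + _ = s / 2 * (c * c^* - 1)); last by field.
by rewrite cc subrr mulr0.
Qed.

Fixpoint twists a n : {linear H -> H} :=
  if n is m.+1 then twists a m \o twist m (a m) else idfun.

Lemma twistsS a n v : twists a n.+1 v = twists a n (twist n (a n) v).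
Proof. by []. Qed.

Lemma rnorm_twists B a n v : phase B a -> rnorm (twists a n v) = rnorm v.
Proof.
by move=> [a1 _]; elim: n v => [//|n IH] v; rewrite twistsS IH rnorm_twist.
Qed.

Lemma twists_twistC a n j c v :
  twists a n (twist j c v) = twist j c (twists a n v).
Proof. by elim: n v => [//|n IH] v; rewrite !twistsS twistC IH. Qed.

Lemma twistsM a b n v :
  twists (fun j => a j * b j) n v = twists a n (twists b n v).
Proof.
elim: n v => [//|n IH] v; rewrite !twistsS IH twistM.
by rewrite [twists b n (twist _ _ _)]twists_twistC.
Qed.

Lemma twists_id a n v : (forall j, (j < n)%N -> a j = 1 \/ tau j v = v) ->
  twists a n v = v.
Proof.
elim: n => [//|n IH] fx; rewrite twistsS (_ : twist n (a n) v = v).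
  by apply: IH => j jn; apply: fx; rewrite ltnS ltnW.
by case: (fx n (leqnn _)) => [->|]; [rewrite twist1|exact: twist_fixed].
Qed.

Lemma rnorm_tau j v : rnorm (tau j v) = rnorm v.
Proof. by apply: rnorm_isometry => w; exact: tau_iso. Qed.

Lemma twists_step B a n v : phase B a ->
  rnorm (twists a n.+1 v - twists a n v) <= B / 4 ^+ n * rnorm v.
Proof.
move=> aB; rewrite twistsS -linearB (rnorm_twists _ _ aB) twistE addrC addKr.
have -> : rnorm (((a n - 1) / 2) *: (v - tau n v)) =
    rnorm (a n - 1) * (rnorm (v - tau n v) / 2).
  rewrite rnormZ rnormM (_ : rnorm (2^-1 : R[i]) = 2^-1); first by ring.
  apply: complexI; rewrite -rnormE ger0_norm ?invr_ge0 //.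
  by rewrite fmorphV rmorph_nat.
rewrite ler_pM ?rnorm_ge0 ?divr_ge0 ?rnorm_ge0 ?aB.2 //.
have := rdistD v 0 (tau n v); rewrite subr0 sub0r rnormN rnorm_tau; lra.
Qed.

(** The infinite product of the commuting unitaries [twist j (a j)]; it converges
    in operator norm as soon as [a] is a [phase]. *)
Definition itwist a v : H := lim (twists a n v @[n --> \oo]).

(** Factors acting trivially on [v] can be skipped, so only the tail of the geometric
    series bounding the displacement remains. *)
Lemma itwist_near B a v k : phase B a ->
    (forall j, (j < k)%N -> a j = 1 \/ tau j v = v) ->
  cvg (twists a n v @[n --> \oo]) /\
  rnorm (itwist a v - v) <= 2 * B * rnorm v / 4 ^+ k.
Proof.
move=> aB fx; have B0 := phase_ge0 aB.
have [n kn|cv le] :=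
    @geometric_cvg _ _ (fun n => twists a n v) k (B * rnorm v / 2 ^+ k).
  apply: le_trans (twists_step _ _ aB) _.
  rewrite mulrAC -!mulrA ler_wpM2l // ler_wpM2l ?rnorm_ge0 //.
  rewrite -invfM lef_pV2 ?posrE ?mulr_gt0 ?exprn_gt0 //.
  rewrite (_ : 4 = 2 * 2 :> R); last by ring.
  by rewrite exprMn ler_pM2r ?exprn_gt0 ?ler_weXn2l ?ler1n.
split=> //; rewrite -{2}(twists_id fx); apply: le_trans le _.
rewrite (_ : 4 = 2 * 2 :> R); last by ring.
by rewrite exprMn invfM !mulrA.
Qed.

Lemma itwist_cvg B a v : phase B a -> twists a n v @[n --> \oo] --> itwist a v.
Proof. by move=> aB; have [] := @itwist_near B a v 0 aB. Qed.

Arguments itwist_cvg {B a} v _.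

Lemma itwist_linear B a : phase B a -> linear (itwist a).
Proof.
move=> aB k v w; apply: hilbert_cvg_unique (itwist_cvg _ aB) _.
under eq_fun do rewrite linearP.
by apply: cvgD; [apply: cvgZl_tmp|]; exact: itwist_cvg aB.
Qed.

Lemma rnorm_itwist B a v : phase B a -> rnorm (itwist a v) = rnorm v.
Proof.
move=> aB; apply/le_anti/andP; split.
  have := @rnorm_lim_le _ _ _ _ 0 0 (rnorm v) (itwist_cvg v aB).
  rewrite subr0; apply => n _.
  by rewrite subr0 (rnorm_twists _ _ aB).
apply/ler_addgt0Pr => e e0.
have /cvg_rnormP/(_ e e0) near_e := itwist_cvg v aB.
have [n ne] := filter_ex near_e.
rewrite -(rnorm_twists n v aB) -{1}[twists a n v](subrK (itwist a v)) addrC.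
by apply: le_trans (rnormD _ _) _; rewrite lerD2l rdistC.
Qed.

Lemma itwist_stationary a k v :
  (forall j, (k <= j)%N -> a j = 1) -> itwist a v = twists a k v.
Proof.
move=> a1; apply: cvg_lim; first exact: norm_hausdorff.
apply/cvg_rnormP => e e0; near=> n.
have /subnKC <- : (k <= n)%N by near: n; exact: nbhs_infty_ge.
elim: (n - k)%N => [|m IH]; first by rewrite addn0 subrr rnorm0 ltW.
by rewrite addnS twistsS a1 ?leq_addr // twist1.
Unshelve. all: by end_near. Qed.

Lemma itwistM A B a b v : phase A a -> phase B b ->
  itwist (fun j => a j * b j) v = itwist a (itwist b v).
Proof.
move=> aA bB; apply: hilbert_cvg_unique (itwist_cvg _ (phaseM aA bB)) _.
apply/cvg_rnormP => e e0.
have e2 : 0 < e / 2 by rewrite divr_gt0.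
have /cvg_rnormP/(_ _ e2) nb := itwist_cvg v bB.
have /cvg_rnormP/(_ _ e2) na := itwist_cvg (itwist b v) aA.
near=> n; rewrite twistsM.
apply: le_trans (rdistD _ (twists a n (itwist b v)) _) _.
rewrite -linearB (rnorm_twists _ _ aA) [leRHS]splitr lerD //; near: n => //.
Unshelve. all: by end_near. Qed.

(** [itwist a] is linear only when its defining products converge; carrying the
    proof of [phase B a] allows the linear structure to be attached. *)
Definition itwist_map B a of phase B a := itwist a.

HB.instance Definition _ B a (aB : phase B a) :=
  GRing.isLinear.Build R[i] H H *:%R (itwist_map aB) (itwist_linear aB).

Lemma itwistB B a v w : phase B a -> itwist a (v - w) = itwist a v - itwist a w.
Proof. by move=> aB; exact: (linearB (itwist_map aB)). Qed.

Lemma itwist_continuous B a (u : nat -> H) x : phase B a ->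
  u @ \oo --> x -> itwist a (u n) @[n --> \oo] --> itwist a x.
Proof.
move=> aB /cvg_rnormP ux; apply/cvg_rnormP => e e0.
apply: filterS (ux e e0) => n un.
by rewrite -(itwistB _ _ aB) (rnorm_itwist _ aB).
Qed.

Lemma itwist_flip N v : itwist (flip_phase R N) v = tau N v.
Proof.
rewrite (@itwist_stationary _ N.+1) => [|j Nj];
  last by rewrite /flip_phase gtn_eqF.
rewrite twistsS {2}/flip_phase eqxx twistN1 twists_id // => j jN.
by left; rewrite /flip_phase ltn_eqF.
Qed.

Lemma itwist1 a v : (forall j, a j = 1) -> itwist a v = v.
Proof. by move=> a1; rewrite (@itwist_stationary a 0). Qed.

Variable c : nat -> R[i].
Hypothesis c_phase : phase 3 c.
Hypothesis c_lacunary : lacunary c.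

Definition twist_rep (n : int) : {linear H -> H} :=
  itwist_map (pows_phase c_phase n).

Lemma twist_rep0 v : twist_rep 0 v = v.
Proof. exact: itwist1. Qed.

Lemma twist_repD m n v : twist_rep (m + n) v = twist_rep m (twist_rep n v).
Proof.
rewrite -[LHS]/(itwist _ _) (powsD c_phase).
exact: itwistM (pows_phase c_phase m) (pows_phase c_phase n).
Qed.

Lemma twist_rep_unitary : unitary_representation twist_rep.
Proof.
split; [move=> n; split|exact: twist_rep0|exact: twist_repD].
  by exists (twist_rep (- n)) => v; rewrite -twist_repD ?addNr ?subrr twist_rep0.
by apply: isometry_of_rnorm => v; exact: rnorm_itwist (pows_phase c_phase n).
Qed.

(** At the time [h] attached to [N], the representation is close to [tau N] in
    operator norm, so that an eigenvector is almost an eigenvector of every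
    [tau N]. *)
Lemma eigenvector_flip v (l : R[i]) : v != 0 -> twist_rep 1 v = l *: v ->
  forall N, exists2 m : R[i], rnorm m = 1 &
    rnorm (m *: v - tau N v) <= 6 * rnorm v / 4 ^+ N.
Proof.
move=> v0 lv N; have [h [a [aP a1 hE]]] := pows_half c_phase c_lacunary N.
have nv : rnorm v != 0 by apply: contra v0 => /eqP/rnorm_eq0 ->.
have l1 : rnorm l = 1.
  apply: (mulIf nv); rewrite mul1r -rnormZ -lv.
  exact: rnorm_itwist (pows_phase c_phase 1).
have lh : twist_rep h v = l ^+ h *: v.
  elim: (h) => [|n IH]; first by rewrite twist_rep0 scale1r.
  by rewrite -add1n PoszD twist_repD IH linearZ /= lv scalerA -exprSr.
exists (l ^+ h); first exact: (rnorm_expz h l1).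
rewrite -lh -[twist_rep h v]/(itwist (pows c h) v) hE.
rewrite (itwistM _ aP (phase_flip R N)) itwist_flip.
have [|_ le] := @itwist_near 3 a (tau N v) N aP.
  by move=> j jN; left; rewrite a1 // ltnW.
apply: le_trans le _; rewrite rnorm_tau; lra.
Qed.

(** The cocycle is the formal coboundary of [\sum_k F k], a divergent series. Since
    [F k] is fixed by the first [k] reflections, [itwist a] moves it by
    [O(2 ^- k)] only and the displacements can be summed. *)
Variable F : nat -> H.
Hypothesis F_fixed : forall j k, (j < k)%N -> tau j (F k) = F k.
Hypothesis F_norm : forall k, rnorm (F k) <= 2 ^+ k.

Definition cocycle_sum a K : H := \sum_(k < K) (itwist a (F k) - F k).

Lemma cocycle_sumS a K :
  cocycle_sum a K.+1 = cocycle_sum a K + (itwist a (F K) - F K).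
Proof. exact: big_ord_recr. Qed.

Definition cocycle a : H := lim (cocycle_sum a K @[K --> \oo]).

(** The displacement of [F n] is at most [2 * B * 2 ^+ n / 4 ^+ n]. *)
Lemma cocycle_cvg B a : phase B a ->
  cocycle_sum a K @[K --> \oo] --> cocycle a /\ rnorm (cocycle a) <= 4 * B.
Proof.
move=> aB; have B0 := phase_ge0 aB.
have [n _|cv le] := @geometric_cvg _ _ (cocycle_sum a) 0 (2 * B).
  rewrite cocycle_sumS addrAC subrr add0r.
  have [j jn|_ le] := @itwist_near B a (F n) n aB; first by right; exact: F_fixed.
  apply: le_trans le _; rewrite -mulrA ler_wpM2l ?mulr_ge0 //.
  rewrite ler_pdivrMr ?exprn_gt0 // (_ : 4 = 2 * 2 :> R); last by ring.
  by rewrite exprMn mulrA mulVf ?mul1r // expf_neq0 ?pnatr_eq0.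
split=> //; move: le; rewrite {2}/cocycle_sum big_ord0 subr0 divr1 -/(cocycle a).
by move/le_trans; apply; lra.
Qed.

Lemma cocycleM A B a b : phase A a -> phase B b ->
  cocycle (fun j => a j * b j) = itwist a (cocycle b) + cocycle a.
Proof.
move=> aA bB; have [ca _] := cocycle_cvg aA; have [cb _] := cocycle_cvg bB.
have [cab _] := cocycle_cvg (phaseM aA bB).
apply: hilbert_cvg_unique cab _; have -> : cocycle_sum (fun j => a j * b j) =
    (fun K => itwist a (cocycle_sum b K)) + cocycle_sum a.
  apply/funext => K; rewrite fctE /cocycle_sum.
  rewrite -[itwist a _]/(itwist_map aA _) linear_sum -big_split.
  by apply: eq_bigr => k _ /=; rewrite linearB addrA subrK (itwistM _ aA bB).
by apply: cvgD => //; exact: itwist_continuous aA cb.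
Qed.

Lemma cocycle_flip N :
  cocycle (flip_phase R N) = \sum_(k < N.+1) (tau N (F k) - F k).
Proof.
have [cN _] := cocycle_cvg (phase_flip R N); apply: hilbert_cvg_unique cN _.
apply/cvg_rnormP => e e0; near=> K.
have /subnKC <- : (N.+1 <= K)%N by near: K; exact: nbhs_infty_ge.
elim: (K - N.+1)%N => [|m IH].
  rewrite addn0 [cocycle_sum _ _](eq_bigr (fun k : 'I_N.+1 => tau N (F k) - F k)).
    by rewrite subrr rnorm0 ltW.
  by move=> k _; rewrite itwist_flip.
by rewrite addnS cocycle_sumS itwist_flip F_fixed ?leq_addr // subrr addr0.
Unshelve. all: by end_near. Qed.

Definition twist_cocycle (n : int) : H := cocycle (pows c n).

Lemma twist_affine_isometric : affine_isometric_action twist_rep twist_cocycle.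
Proof.
split; first exact: twist_rep_unitary.
split=> [v|m n v]; rewrite /affine_map /twist_cocycle.
  rewrite twist_rep0 -[RHS]addr0; congr (_ + _).
  have [c0 _] := cocycle_cvg (pows_phase c_phase 0).
  apply: hilbert_cvg_unique c0 _.
  have -> : cocycle_sum (pows c 0) = fun=> 0.
    apply/funext => K; rewrite /cocycle_sum big1 // => k _.
    by rewrite itwist1 ?subrr.
  exact: cvg_cst.
rewrite twist_repD (powsD c_phase).
by rewrite (cocycleM (pows_phase c_phase m) (pows_phase c_phase n)) linearD addrA.
Qed.

(** The times [2 h] of the lacunary phases tend to infinity, while the phases they
    give obey the same bound [3], so that the cocycle stays below [4 * 3]. *)
Lemma twist_not_proper : ~ proper_action (affine_map twist_rep twist_cocycle).
Proof.
move=> [v /(_ (rnorm v + 13)) [N NP]].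
have [h [Nh hP]] := phase_pows_double c_phase c_lacunary N.
have Nh2 : (N <= `|h.*2 : int|)%N by rewrite absz_nat; lia.
have := NP _ Nh2; rewrite rnormE lecR; apply/negP; rewrite -ltNge.
apply: le_lt_trans (rnormD _ _) _.
rewrite -[twist_rep _ _]/(itwist _ _) (rnorm_itwist _ hP).
by have [_] := cocycle_cvg hP; rewrite /twist_cocycle; lra.
Qed.

(** At the time [h] attached to [N] the cocycle has, up to an error of at most
    [4 * 3], the norm of its value at the exact flip [tau N], which is the sum in
    the hypothesis. *)
Lemma twist_not_bounded :
    (forall N, N.+1%:R <= rnorm (\sum_(k < N.+1) (tau N (F k) - F k))) ->
  ~ bounded_action (affine_map twist_rep twist_cocycle).
Proof.
move=> Fbig /(_ 0) /pinfty_ex_gt0 [M M0 Mb].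
have [r r0 rE] := posC_real M0.
pose N := Num.bound (r + 12).
have [h [a [aP a1 hE]]] := pows_half c_phase c_lacunary N.
have := Mb (affine_map twist_rep twist_cocycle h 0)
  (ex_intro2 _ _ _ (I : [set: int] h) erefl).
rewrite /= rE rnormE lecR; apply/negP; rewrite -ltNge.
rewrite /affine_map linear0 add0r /twist_cocycle hE.
rewrite (cocycleM aP (phase_flip R N)) cocycle_flip.
have [_ ca] := cocycle_cvg aP.
have := rnormB (itwist a (\sum_(k < N.+1) (tau N (F k) - F k))) (- cocycle a).
rewrite opprK rnormN (rnorm_itwist _ aP).
have : r + 12 < N%:R.
  by apply: archi_boundP; rewrite addr_ge0 ?(ltW r0).
have := Fbig N; rewrite -natr1; lra.
Qed.

End Reflections.

(** * Eigenvectors of finite-dimensional invariant subspaces *)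

(** [U] is represented on coefficient vectors by some matrix [A], even if the
    spanning family [e] is not free. By Cayley-Hamilton the product of the
    [A - l] over the roots [l] of the characteristic polynomial kills every
    vector; applying the factors one by one to a nonzero vector, the last nonzero
    result is an eigenvector. *)
Lemma finite_dim_eigenvector (C : numClosedFieldType) (V : lmodType C)
    (U : {linear V -> V}) (d : nat) (e : 'I_d -> V)
    (W := [set \sum_(i < d) c i *: e i | c in [set: 'I_d -> C]]) :
    (forall v, W v -> W (U v)) -> W != [set 0] ->
  exists (v : V) (l : C), v != 0 /\ U v = l *: v.
Proof.
case: d e @W => [|d] e W UW W0.
  exfalso; move/eqP: W0; apply; apply/seteqP; split=> [_ [c _ <-]|_ ->] /=.
    by rewrite big_ord0.
  by exists (fun=> 0) => //; rewrite big_ord0.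
have [v [Wv v0]] : exists v, W v /\ v != 0.
  apply: contrapT => nv; move/eqP: W0; apply; apply/seteqP.
  split=> [v Wv|_ ->] /=.
    by apply: contrapT => v0; apply: nv; exists v; split=> //; exact/eqP.
  by exists (fun=> 0) => //; rewrite big1 // => i _; rewrite scale0r.
pose Phi (x : 'rV[C]_d.+1) := \sum_i x 0 i *: e i.
have PhiB x l y : Phi (x - l *: y) = Phi x - l *: Phi y.
  rewrite /Phi scaler_sumr -sumrB; apply: eq_bigr => i _.
  by rewrite !mxE scalerBl scalerA.
have [A AE] : exists A : 'M[C]_d.+1, forall x, Phi (x *m A) = U (Phi x).
  have We i : W (e i).
    exists (fun j => (j == i)%:R) => //.
    rewrite (bigD1 i) //= eqxx scale1r big1 ?addr0 // => j /negPf ->.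
    by rewrite scale0r.
  have /choice [g gE] : forall i,
      exists c : 'I_d.+1 -> C, \sum_j c j *: e j = U (e i).
    by move=> i; have [c _ <-] := UW _ (We i); exists c.
  exists (\matrix_(i, j) g i j) => x; rewrite /Phi linear_sum.
  under eq_bigr do rewrite mxE scaler_suml.
  rewrite exchange_big; apply: eq_bigr => i _.
  rewrite linearZ /= -gE scaler_sumr; apply: eq_bigr => j _.
  by rewrite mxE scalerA.
have [c _ cv] := Wv.
pose x : 'rV_d.+1 := \row_i c i.
have xv : Phi x = v by rewrite -cv; apply: eq_bigr => i _; rewrite mxE.
have [s sE] := closed_field_poly_normal (char_poly A).
have : Phi (x *m \prod_(l <- s) (A - l%:M)) = 0.
  have : horner_mx A (\prod_(l <- s) ('X - l%:P)) = 0.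
    have := Cayley_Hamilton A; rewrite {1}sE.
    by rewrite (eqP (char_poly_monic A)) scale1r.
  rewrite rmorph_prod /=.
  under eq_bigr do rewrite rmorphB /= horner_mx_X horner_mx_C.
  by move=> ->; rewrite mulmx0 /Phi big1 // => i _; rewrite mxE scale0r.
have : Phi x != 0 by rewrite xv.
elim: s x {xv sE} => [|l s IH] x x0.
  by rewrite big_nil mulmx1 => /eqP; rewrite (negPf x0).
rewrite big_cons -mulmxE mulmxA mulmxBr mul_mx_scalar.
have [y0 _|] := eqVneq (Phi (x *m A - l *: x)) 0; last exact: IH.
exists (Phi x), l; split=> //; apply/eqP; rewrite -subr_eq0 -AE.
by rewrite -PhiB y0.
Qed.

(** * Binary digit flips on square summable sequences *)

(** Binary expansion identifies [nat] with the group of finitely supported sequences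
    of bits; [flip j] is the translation by the [j]-th generator. *)
Definition flip (j i : nat) : nat := Nat.lxor i (Nat.pow 2 j).

Lemma pow_expn j : Nat.pow 2 j = (2 ^ j)%N.
Proof. by elim: j => // j IH; rewrite expnS -IH. Qed.

Lemma flipK j : involutive (flip j).
Proof.
by move=> i; rewrite /flip Nat.lxor_assoc Nat.lxor_nilpotent Nat.lxor_0_r.
Qed.

Lemma flipC j k i : flip j (flip k i) = flip k (flip j i).
Proof.
by rewrite /flip !Nat.lxor_assoc [Nat.lxor (Nat.pow 2 k) _]Nat.lxor_comm.
Qed.

Lemma lxor_lt_pow a b k :
  (a < 2 ^ k)%N -> (b < 2 ^ k)%N -> (Nat.lxor a b < 2 ^ k)%N.
Proof.
rewrite -pow_expn => /ssrnat.ltP ak /ssrnat.ltP bk; apply/ssrnat.ltP.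
have [->|ab] := eqVneq (Nat.lxor a b) 0%N.
  by rewrite pow_expn; apply/ssrnat.ltP; rewrite expn_gt0.
have k0 : (0 < k)%coq_nat.
  case: k ak bk => [|k] /= ak bk; last lia.
  have [a0 b0] : a = 0%N /\ b = 0%N by split; lia.
  by rewrite a0 b0 in ab.
apply/Nat.log2_lt_pow2; first by apply/ssrnat.ltP; rewrite lt0n.
have lg x : (x < Nat.pow 2 k)%coq_nat -> (Nat.log2 x < k)%coq_nat.
  by case: x => [|x] xk //; apply/Nat.log2_lt_pow2 => //; lia.
by have := Nat.log2_lxor a b; have := lg _ ak; have := lg _ bk; lia.
Qed.

Lemma flip_lt j k i : (j < k)%N -> (flip j i < 2 ^ k)%N = (i < 2 ^ k)%N.
Proof.
move=> jk; have lt m : (m < 2 ^ k)%N -> (flip j m < 2 ^ k)%N.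
  by move=> mk; apply: lxor_lt_pow; rewrite // pow_expn ltn_exp2l.
by apply/idP/idP=> /lt //; rewrite flipK.
Qed.

Lemma flip_ge N i : (i < 2 ^ N)%N -> (2 ^ N <= flip N i)%N.
Proof.
move=> iN; rewrite leqNgt; apply/negP => fN.
have := lxor_lt_pow iN fN.
rewrite /flip -Nat.lxor_assoc Nat.lxor_nilpotent Nat.lxor_0_l.
by rewrite pow_expn ltnn.
Qed.

Lemma sum_flip (V : zmodType) (f : nat -> V) j k : (j < k)%N ->
  \sum_(i < 2 ^ k) f (flip j i) = \sum_(i < 2 ^ k) f i.
Proof.
move=> jk; have fP (i : 'I_(2 ^ k)) : (flip j i < 2 ^ k)%N by rewrite flip_lt.
rewrite [RHS](reindex_inj (h := fun i => Ordinal (fP i))) //.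
by move=> x y [] /(can_inj (flipK j)) /val_inj.
Qed.

Section FlipL2.
Variable R : realType.
Implicit Types v w : l2 R.

(** The partial sums of both series agree at the indices [2 ^ k] with [j < k]. *)
Lemma series_flip (f : nat -> R) j (l m : R) :
  series f @ \oo --> l -> series (f \o flip j) @ \oo --> m -> l = m.
Proof.
move=> fl fm; have p2 : (2 ^ k)%N @[k --> \oo] --> \oo.
  apply/cvgnyPge => A; near=> k; apply: (@leq_trans k); last exact/ltnW/ltn_expl.
  by near: k; exact: nbhs_infty_ge.
have fl2 : series f (2 ^ k)%N @[k --> \oo] --> l by exact: cvg_comp p2 fl.
have fm2 : series (f \o flip j) (2 ^ k)%N @[k --> \oo] --> m.
  exact: cvg_comp p2 fm.
apply: (cvg_unique (@norm_hausdorff _ R) fl2); apply: cvg_trans fm2.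
apply: near_eq_cvg; near=> k.
rewrite /series /= !big_mkord sum_flip //; near: k; exact: nbhs_infty_gt.
Unshelve. all: by end_near. Qed.

Lemma l2_flip_subproof j v : (v \o flip j) \in @l2_pred R.
Proof.
apply/asboolP; apply: (@sq_summable_bounded _ _ (l2sq v)) => n.
pose k := maxn n j.+1.
have nk : (n <= 2 ^ k)%N.
  by rewrite (leq_trans (leq_maxl n j.+1)) // ltnW // ltn_expl.
apply: le_trans (l2sq_ge v (2 ^ k)); rewrite -(@sum_flip _ (fun i => sqn (v i)) j).
  rewrite -!(big_mkord xpredT (fun i => sqn (v (flip j i)))).
  rewrite (big_cat_nat (leq0n _) nk) /=.
  by rewrite lerDl sumr_ge0 // => i _; exact: sqn_ge0.
by rewrite leq_max leqnn orbT.
Qed.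

Definition l2_flip j v : l2 R := L2 (l2_flip_subproof j v).

Lemma l2_flip_linear j : linear (l2_flip j).
Proof. by move=> a v w; exact: l2_ext. Qed.

HB.instance Definition _ j :=
  GRing.isLinear.Build R[i] (l2 R) (l2 R) *:%R (l2_flip j) (l2_flip_linear j).

Lemma l2dot_flip j v w : l2dot (l2_flip j v) (l2_flip j w) = l2dot v w.
Proof.
have [fR fI] := l2dot_csum (l2_flip j v) (l2_flip j w).
have [vR vI] := l2dot_csum v w.
apply/eqP; rewrite eq_complex; apply/andP; split; apply/eqP/esym.
  exact: series_flip vR fR.
exact: series_flip vI fI.
Qed.

Lemma sum_sqn_ind n m :
  \sum_(i < m) sqn (if (i < n)%N then 1 else 0 : R[i]) = (minn m n)%:R.
Proof.
elim: m => [|m IH]; first by rewrite big_ord0 min0n.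
rewrite big_ord_recr IH /=; case: ltnP => mn; rewrite /sqn /= !expr0n /= addr0.
  by rewrite expr1n natr1 (minn_idPl mn).
by rewrite addr0 (minn_idPr (leqW mn)).
Qed.

Lemma l2_ind_subproof n :
  (fun i => if (i < n)%N then 1 else 0 : R[i]) \in @l2_pred R.
Proof.
apply/asboolP; apply: (@sq_summable_bounded _ _ n%:R) => m.
by rewrite sum_sqn_ind ler_nat geq_minr.
Qed.

Definition l2_ind n : l2 R := L2 (l2_ind_subproof n).

Lemma rnorm_l2_ind k : rnorm (l2_ind (2 ^ k)) <= 2 ^+ k.
Proof.
rewrite -(@ler_pXn2r _ 2) ?nnegrE ?rnorm_ge0 ?exprn_ge0 // l2_rnorm_sqr.
apply: (@le_trans _ _ (2 ^+ k)).
  by apply: l2sq_le => n; rewrite sum_sqn_ind -natrX ler_nat geq_minr.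
by rewrite expr2 ler_peMr ?exprn_ge0 ?exprn_ege1 ?ler1n.
Qed.

Lemma l2_flip_ind j k : (j < k)%N -> l2_flip j (l2_ind (2 ^ k)) = l2_ind (2 ^ k).
Proof. by move=> jk; apply: l2_ext => i /=; rewrite flip_lt. Qed.

Lemma l2_coord_sum (I : finType) (f : I -> l2 R) n : (\sum_i f i) n = \sum_i f i n.
Proof. exact: (big_morph (fun v : l2 R => v n)). Qed.

(** The coordinate of index [0] of the sum is [- N.+1], because [flip N 0 = 2 ^ N]
    lies outside the support of each indicator. *)
Lemma flip_ind_sum_ge N : N.+1%:R <=
  rnorm (\sum_(k < N.+1) (l2_flip N (l2_ind (2 ^ k)) - l2_ind (2 ^ k))).
Proof.
apply: le_trans (rnorm_coord _ 0); rewrite l2_coord_sum.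
rewrite (eq_bigr (fun=> -1)) => [|k _]; last first.
  rewrite l2_subE /= expn_gt0 /= ltnNge.
  rewrite (leq_trans _ (flip_ge _)) ?expn_gt0 ?sub0r //.
  by rewrite leq_exp2l // -ltnS.
rewrite sumr_const card_ord mulNrn rnormN -lecR -rnormE normr_nat.
by rewrite rmorph_nat.
Qed.

Lemma l2_coord_cvg0 v (e : R) : 0 < e -> \forall i \near \oo, rnorm (v i) <= e.
Proof.
move=> e0; have /cvgr0Pnorm_lt := cvg_series_cvg_0 (@l2P _ v).
move=> /(_ (e ^+ 2) (exprn_gt0 _ e0)); apply: filterS => i.
rewrite ger0_norm ?sqn_ge0 // -rnorm_sqr => /ltW.
by rewrite ler_pXn2r ?nnegrE ?rnorm_ge0 ?(ltW e0).
Qed.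

(** For fixed [i], the index [flip N i] tends to infinity with [N], so the
    coordinate [v (flip N i)] tends to [0]; yet its modulus is almost that of
    [v i]. *)
Lemma l2_flip_not_scalar v : (forall N, exists2 m : R[i], rnorm m = 1 &
    rnorm (m *: v - l2_flip N v) <= 6 * rnorm v / 4 ^+ N) -> v = 0.
Proof.
move=> vP; apply: l2_ext => i; apply: rnorm_eq0; apply/le_anti.
rewrite rnorm_ge0 andbT; apply/ler_addgt0Pr => e e0; rewrite add0r.
have e2 : 0 < e / 2 by rewrite divr_gt0.
have [A _ AP] := l2_coord_cvg0 v e2.
have [n nP] := half_pow_small (6 * rnorm v) e2.
pose N := maxn (maxn A i) n; have [m m1 mP] := vP N.
have iN : (i < 2 ^ N)%N.
  apply: leq_ltn_trans (ltn_expl N (ltnSn 1)).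
  by rewrite /N !leq_max leqnn orbT.
have fA : rnorm (v (flip N i)) <= e / 2.
  apply: AP => /=; apply: leq_trans (flip_ge iN).
  apply: leq_trans (ltnW (ltn_expl N (ltnSn 1))).
  by rewrite /N !leq_max leqnn.
rewrite -[rnorm (v i)]mul1r -m1 -rnormM -(subrK (v (flip N i)) (m * v i)).
apply: le_trans (rnormD _ _) _; rewrite [leRHS]splitr lerD //.
apply: le_trans (ltW nP).
apply: le_trans (rnorm_coord (m *: v - l2_flip N v) i) (le_trans mP _).
rewrite ler_wpM2l ?mulr_ge0 ?rnorm_ge0 // lef_pV2 ?posrE ?exprn_gt0 //.
apply: (@le_trans _ _ (4 ^+ n)).
  by rewrite lerXn2r ?nnegrE ?ler_nat.
by rewrite ler_weXn2l ?ler1n // leq_maxr.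
Qed.

End FlipL2.

(** * The action *)

Theorem proposition1p7 (R : realType) :
  exists (H : hilbertType R) (pi : int -> {linear H -> H}) (b : int -> H),
    [/\ affine_isometric_action pi b,
        ~ proper_action (affine_map pi b),
        ~ bounded_action (affine_map pi b) &
        ~ exists W : set H,
            [/\ subrepresentation pi W, finite_dimensional W & W != [set 0]]].
Proof.
have [c c_phase c_lac] := lacunary_phases R.
pose H := l2_hilbert R.
pose tau (j : nat) : {linear H -> H} := l2_flip j.
have tau_iso j : isometry (hdot H) (hdot H) (tau j).
  by move=> v w; exact: l2dot_flip.
have tauK j v : tau j (tau j v) = v.
  by apply: l2_ext => i /=; rewrite flipK.
have tauC i j v : tau i (tau j v) = tau j (tau i v).
  by apply: l2_ext => k /=; rewrite flipC.
pose F k : H := l2_ind R (2 ^ k).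
have F_fixed j k : (j < k)%N -> tau j (F k) = F k by exact: l2_flip_ind.
have F_norm k : rnorm (F k) <= 2 ^+ k by exact: rnorm_l2_ind.
exists H, (twist_rep tau_iso tauK c_phase), (twist_cocycle tau c F).
split.
- exact: twist_affine_isometric.
- exact: twist_not_proper.
- by apply: twist_not_bounded => // N; exact: flip_ind_sum_ge.
- move=> [W [[_ Winv] [d [e WE]] W0]].
  have := @finite_dim_eigenvector _ _ (twist_rep tau_iso tauK c_phase 1) d e.
  rewrite -WE => /(_ (Winv 1) W0) [v [l [v0 lv]]].
  apply: (negP v0); apply/eqP/l2_flip_not_scalar.
  exact: (eigenvector_flip tauC c_lac v0 lv).
Qed.
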